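(* Let $B$ be a semisimple subalgebra of a semisimple algebra $A$ (both finite-dimensional over $\mathbb{C}$, with the same unit). If $B\subseteq A$ has depth $n$ (where $n\ge 2$), then $B$ is normal in $E_{n-2}$, where $E_{n-2}$ is the corresponding term of the Jones tower above $B\subseteq A$.
   Context: For an inclusion $B \subseteq A$ of finite-dimensional semisimple $\mathbb{C}$-algebras let $V_1,\dots,V_s$ be the simple $A$-modules and $W_1,\dots,W_r$ the simple $B$-modules up to isomorphism; the inclusion matrix is the $r\times s$ matrix $M=(m_{ij})$, where $m_{ij}$ is the multiplicity of $W_i$ in $V_j\!\downarrow_B$. Powers are $M^1=M$, $M^2=MM^t$, $M^3=MM^tM$, etc.; inequalities are entrywise. The depth of $B\subseteq A$ is the least integer $n\ge 2$ such that $M^{n+1}\le qM^{n-1}$ for some positive integer $q$. The Jones tower above $B\subseteq A$: set $E_{-1}=B$, $E_0=A$, and $E_{k+1}=\mathrm{End}\,(E_k)_{E_{k-1}}$ (endomorphisms of $E_k$ as a right $E_{k-1}$-module) for $k\ge 0$, with $E_k$ embedded in $E_{k+1}$ via left multiplication $a\mapsto\lambda_a$, $\lambda_a(x)=ax$. All $E_k$ are semisimple, and $B$ is regarded as a subalgebra of $E_{n-2}$ through the composite embedding. A semisimple subalgebra $S$ of a semisimple algebra $R$ is normal in $R$ if for every maximal two-sided ideal $I$ of $R$ one has $(I\cap S)R=R(I\cap S)$ as subsets of $R$. *)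

(* Defs.v *)
From HB Require Import structures.
From mathcomp Require Import all_boot all_order all_algebra all_field.
From mathcomp Require Import reals complex.

Set Implicit Arguments.
Unset Strict Implicit.
Unset Printing Implicit Defensive.

Import GRing.Theory.
Import FalgLfun.

Local Open Scope ring_scope.

Section ConverseAlgebra.
Variables (K : fieldType) (A : falgType K).

HB.instance Definition _ := Vector.copy A^c A.

Fact converse_scalerAl (a : K) (x y : A^c) : a *: (x * y) = (a *: x : A^c) * y.
Proof. exact: (@scalerAr K A a y x). Qed.
HB.instance Definition _ :=
  GRing.Lmodule_isLalgebra.Build K A^c converse_scalerAl.

Fact converse_scalerAr (a : K) (x y : A^c) : a *: (x * y) = x * (a *: y : A^c).
Proof. exact: (@scalerAl K A a y x). Qed.
HB.instance Definition _ :=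
  GRing.Lalgebra_isAlgebra.Build K A^c converse_scalerAr.

HB.instance Definition _ := Falgebra.on A^c.
End ConverseAlgebra.

Section Modules.

Definition simple_module (R : nzRingType) (V : lmodType R) : Prop :=
  (exists v : V, v != 0) /\
  forall U : {pred V}, GRing.submod_closed U ->
    (forall v, v \in U -> v = 0) \/ (forall v, v \in U).

Definition isomorphic_modules (R : nzRingType) (V W : lmodType R) : Prop :=
  exists f : {linear V -> W}, bijective f.

Definition simple_modules (R : nzRingType) (n : nat)
    (V : 'I_n -> lmodType R) : Prop :=
  [/\ forall i, simple_module (V i),
      forall i j, isomorphic_modules (V i) (V j) -> i = j
    & forall U : lmodType R, simple_module U ->
        exists i, isomorphic_modules U (V i)].

(* V, viewed as an S-module through iota, is isomorphic to the direct sum of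
   m i copies of W i for i < r.  The index p = (i, k) runs over the copies,
   and g p embeds the k-th copy of W i; it is linear for the scaling of V
   by iota b. *)
Definition restriction_multiplicities (S R : nzRingType) (iota : S -> R)
    (r : nat) (W : 'I_r -> lmodType S) (V : lmodType R)
    (m : 'I_r -> nat) : Prop :=
  exists g : forall p : {i : 'I_r & 'I_(m i)},
      {linear W (tag p) -> V | fun b v => iota b *: v},
    bijective (fun w : {ffun forall p : {i : 'I_r & 'I_(m i)}, W (tag p)} =>
                 \sum_p g p (w p)).

Definition inclusion_matrix (S R : nzRingType) (iota : S -> R) (r s : nat)
    (W : 'I_r -> lmodType S) (V : 'I_s -> lmodType R)
    (M : 'M[nat]_(r, s)) : Prop :=
  forall j, restriction_multiplicities iota W (V j) (fun i => M i j).

End Modules.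

Section AlternatingPowers.
Variables (r s : nat) (M : 'M[nat]_(r, s)).

(* Defined so that altdim n.+2 is convertible to altdim n; hence M^n.+2 and
   M^n have the same type. *)
Fixpoint altdim (n : nat) : nat :=
  match n with 0 => r | 1 => s | n'.+2 => altdim n' end.

Fixpoint altfactor (n : nat) : 'M[nat]_(altdim n, altdim n.+1) :=
  match n with 0 => M | 1 => M^T | n'.+2 => altfactor n' end.

(* The product M M^T M ... with n factors. *)
Fixpoint altpow (n : nat) : 'M[nat]_(r, altdim n) :=
  match n with 0 => 1%:M | n'.+1 => altpow n' *m altfactor n' end.

(* M^(n+1) <= q M^(n-1) for some q > 0, for n >= 1: n.-1.+2 stands for n.+1. *)
Definition depth_bound (n : nat) : Prop :=
  exists2 q : nat, (0 < q)%N &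
    forall i j, (altpow n.-1.+2 i j <= q * altpow n.-1 i j)%N.

Definition matrix_depth (n : nat) : Prop :=
  [/\ (2 <= n)%N, depth_bound n
    & forall m, (2 <= m)%N -> depth_bound m -> (n <= m)%N].
End AlternatingPowers.

Section Algebras.
Variables (K : fieldType) (A : falgType K).

(* Ideals of a unital algebra are subspaces, so they are taken in {vspace A}. *)
Definition left_ideal (I : {vspace A}) : Prop := (fullv * I <= I)%VS.

Definition ideal (I : {vspace A}) : Prop :=
  (fullv * I <= I)%VS /\ (I * fullv <= I)%VS.

Definition maximal_ideal (I : {vspace A}) : Prop :=
  [/\ ideal I, I <> fullv
    & forall J, ideal J -> (I <= J)%VS -> J = I \/ J = fullv].

(* The left regular module is semisimple: its submodules have complements. *)
Definition semisimple_algebra : Prop :=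
  forall I, left_ideal I ->
    exists J, [/\ left_ideal J, (I + J)%VS = fullv & (I :&: J)%VS = 0%VS].

Definition normal_subalgebra (S : {vspace A}) : Prop :=
  forall I, maximal_ideal I ->
    ((I :&: S) * fullv = fullv * (I :&: S))%VS.

Definition has_depth (B : {aspace A}) (n : nat) : Prop :=
  exists (r s : nat) (W : 'I_r -> lmodType (subvs_of B))
         (V : 'I_s -> lmodType A) (M : 'M[nat]_(r, s)),
    [/\ simple_modules W, simple_modules V,
        inclusion_matrix (fun b : subvs_of B => vsval b) W V M
      & matrix_depth M n].
End Algebras.

Section RightEndomorphisms.
Variables (K : fieldType) (S R : falgType K) (iota : 'Hom(S, R)).

(* The endomorphisms of R commuting with the right multiplications by the
   elements of iota S. *)
Definition right_endo_space : {aspace 'End(R)} :=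
  'C(linfun (@amulr K R) @: limg iota)%AS.

Lemma right_endoP (f : 'End(R)) :
  f \in right_endo_space <-> forall x b, f (x * iota b) = f x * iota b.
Proof.
split=> [/centvP fC x b | fC].
  have /fC/lfunP/(_ x) : linfun (@amulr K R) (iota b) \in
      (linfun (@amulr K R) @: limg iota)%VS.
    by rewrite !memv_img ?memvf.
  by rewrite !lfun_mulE !lfunE.
apply/centvP=> _ /memv_imgP[_ /memv_imgP[b _ ->] ->]; apply/lfunP=> x.
by rewrite !lfun_mulE !lfunE /= fC.
Qed.

(* The product of 'End(R) is (f * g) x = g (f x), while right-module
   endomorphisms are multiplied by (f * g) x = f (g x): hence the converse. *)
Definition right_endo : falgType K := (subvs_of right_endo_space)^c.

Definition right_endo_fun (f : right_endo) : 'End(R) :=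
  vsval (f : subvs_of right_endo_space).

Lemma right_endo1 x : right_endo_fun 1 x = x.
Proof.
have e1 : algid right_endo_space = 1.
  by apply/eqP; rewrite algid_eq1 centv1.
by rewrite [right_endo_fun 1]e1 id_lfunE.
Qed.

Lemma right_endoM f g x :
  right_endo_fun (f * g) x = right_endo_fun f (right_endo_fun g x).
Proof. by rewrite -lfun_mulE. Qed.

Lemma amull_right_endo x : amull x \in right_endo_space.
Proof. by apply/right_endoP=> y b; rewrite !lfunE /= mulrA. Qed.

(* The embedding a |-> lambda_a, lambda_a x = a x; by [amull_right_endo], the
   projection onto right_endo_space acts as the identity here. *)
Definition left_mult : 'Hom(R, right_endo) :=
  (linfun (vsproj right_endo_space) \o linfun (@amull K R))%VF.

Lemma left_multE a x : right_endo_fun (left_mult a) x = a * x.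
Proof.
rewrite /right_endo_fun /left_mult comp_lfunE !lfunE /=.
by rewrite vsprojK ?amull_right_endo // lfunE.
Qed.
End RightEndomorphisms.

Record extension (K : fieldType) := Extension {
  lower : falgType K;
  upper : falgType K;
  embedding : 'Hom(lower, upper)
}.

Section JonesTower.
Variables (K : fieldType) (A : falgType K) (B : {aspace A}).

(* jones k is the extension E_(k-1) -> E_k, starting with E_(-1) = B and
   E_0 = A. *)
Fixpoint jones (k : nat) : extension K :=
  if k is k'.+1 then Extension (left_mult (embedding (jones k')))
  else Extension (linfun (vsval : subvs_of B -> A)).

Definition jones_algebra (k : nat) : falgType K := upper (jones k).

Fixpoint jones_embedding (k : nat) : 'Hom(subvs_of B, jones_algebra k) :=
  if k is k'.+1 then (embedding (jones k'.+1) \o jones_embedding k')%VF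
  else embedding (jones 0).

Definition jones_base (k : nat) : {vspace jones_algebra k} :=
  limg (jones_embedding k).
End JonesTower.

(* Main.v *)
(* A block of a semisimple algebra is a central idempotent e such that every
   two-sided ideal contains e or is killed by e.  Blocks e of S and f of R are
   linked along S -> R when e f <> 0, so the links are the support of the
   inclusion matrix.  A nondegenerate trace form on A restricts to one on B, which
   makes A a Frobenius extension of B, and End(E_k) over E_(k-1) is again a
   Frobenius extension of E_k, whose blocks are the right multiplications by the
   blocks of E_(k-1).  Hence the links of E_k in E_(k+1) are the transposes of
   those of E_(k-1) in E_k, and the links of B in E_k are the support of M^(k+1).
   Depth n forces any two columns of M^(n-1) to have equal or disjoint supports.
   A maximal ideal N of E_(n-2) is the annihilator of a block f, and then the sum
   of the blocks e of B with e f = 0 is a central idempotent of E_(n-2) that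
   generates N :&: B as an ideal of B; this gives normality. *)
Require Import Defs.
From HB Require Import structures.
From mathcomp Require Import all_boot all_order all_algebra all_field.
From mathcomp Require Import boolp reals complex.

Set Implicit Arguments.
Unset Strict Implicit.
Unset Printing Implicit Defensive.

Import GRing.Theory.
Import FalgLfun passmx.

Local Open Scope ring_scope.

(** * Subspaces given by predicates, and the trace of the regular representation *)

Section LinearAlgebra.
Variables (K : fieldType).

(** A subspace of largest dimension inside [P] exhausts [P], since otherwise a line could be added
    to it. *)
Lemma vspace_of_prop (V : vectType K) (P : V -> Prop) :
    P 0 -> (forall a x y, P x -> P y -> P (a *: x + y)) ->
  exists U : {vspace V}, forall x, x \in U <-> P x.
Proof.
move=> P0 Plin.
pose sub d := `[< exists2 U : {vspace V}, \dim U = d & forall x, x \in U -> P x >].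
have sub0 : exists d, sub d.
  exists 0%N; apply/asboolP; exists 0%VS; first exact: dimv0.
  by move=> x /[!memv0]/eqP->.
have sub_le d : sub d -> (d <= \dim {:V})%N.
  by move=> /asboolP[U <- _]; rewrite dimvS ?subvf.
have [d /asboolP[U dU UP] d_max] := ex_maxnP sub0 sub_le.
exists U => x; split=> [|Px]; first exact: UP.
have /d_max : sub (\dim (U + <[x]>)).
  apply/asboolP; exists (U + <[x]>)%VS => // _ /memv_addP[u uU [_ /vlineP[k ->] ->]].
  by rewrite addrC; apply: Plin => //; apply: UP.
rewrite -dU => le_dim.
have /eqP -> : U == (U + <[x]>)%VS by rewrite eqEdim addvSl.
by rewrite (subvP (addvSr U _)) ?memv_line.
Qed.

Lemma lfun_of_linear (V W : vectType K) (f : V -> W) :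
  linear f -> exists g : 'Hom(V, W), g =1 f.
Proof.
move=> f_lin.
pose m := GRing.isSemilinear.Build K V W _ f (GRing.semilinear_linear f_lin).
pose fl : {linear V -> W} := HB.pack f m.
by exists (linfun fl) => x; rewrite lfunE.
Qed.

(** For a full-rank factorization [P = C D], idempotence forces [D C = 1], and [C D] and [D C] have
    equal traces. *)
Lemma mxtrace_idem n (P : 'M[K]_n) : P *m P = P -> \tr P = (\rank P)%:R.
Proof.
move=> idP; have := mulmx_base P.
move: (col_base P) (row_base P) (col_base_full P) (row_base_free P).
move=> C D fullC freeD defP.
have : C *m (D *m C) *m D = C *m 1%:M *m D.
  by rewrite mulmx1 -!mulmxA defP mulmxA defP.
move/(row_free_inj freeD)/(row_full_inj fullC) => DC1.
by rewrite -[in LHS]defP mxtrace_mulC DC1 mxtrace1.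
Qed.

(** [t x] is the trace of right multiplication by [x]. On an idempotent it is a rank, which
    characteristic 0 keeps nonzero in [K]. *)
Lemma algebra_trace (A : falgType K) : [pchar K] =i pred0 ->
  exists t : 'Hom(A, K^o),
    (forall x y, t (x * y) = t (y * x)) /\
    (forall e, e * e = e -> t e = 0 -> e = 0).
Proof.
move=> charK; pose b := vbasis {:A}.
have b_basis : basis_of fullv b by exact: vbasisP.
pose T x := mxof b b (amulr x).
have TM x y : T (x * y) = T x *m T y.
  by rewrite /T rmorphM -lfun_compE (mxof_comp b b b_basis).
have [t tE] : exists t : 'Hom(A, K^o), t =1 (fun x => \tr (T x)).
  apply: lfun_of_linear => a x y; rewrite /T.
  by rewrite !linearP /=.
exists t; split=> [x y | e idem]; first by rewrite !tE !TM mxtrace_mulC.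
rewrite tE mxtrace_idem; last by rewrite -TM idem.
move/pcharf0P: charK => nat_eq0 /eqP; rewrite nat_eq0.
rewrite mxrank_eq0 mxof_eq0 // => /eqP/lfunP/(_ 1).
by rewrite !lfunE /= mul1r.
Qed.

End LinearAlgebra.

(** * Ideals and trace forms of a semisimple algebra *)

Section Ideals.
Variables (K : fieldType) (A : falgType K).
Implicit Types (I : {vspace A}).

Lemma left_idealP I : left_ideal I <-> forall a x, x \in I -> a * x \in I.
Proof.
split=> [/prodvP HI a x | HI]; first by apply: HI; rewrite memvf.
by apply/prodvP=> a x _; apply: HI.
Qed.

Lemma idealP I :
  ideal I <-> (forall a x, x \in I -> a * x \in I) /\
              (forall a x, x \in I -> x * a \in I).
Proof.
split=> [[/prodvP Hl /prodvP Hr] | [Hl Hr]].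
  by split=> a x xI; [apply: Hl | apply: Hr]; rewrite ?memvf.
by split; apply/prodvP=> a x aI xI; [apply: Hl | apply: Hr].
Qed.

Lemma left_ideal_of_prop (P : A -> Prop) :
    P 0 -> (forall x y, P x -> P y -> P (x + y)) ->
    (forall a x, P x -> P (a * x)) ->
  exists2 I, left_ideal I & forall x, x \in I <-> P x.
Proof.
move=> P0 PD PM.
have [I IP] : exists I, forall x, x \in I <-> P x.
  apply: vspace_of_prop => // a x y Px Py; apply: (PD) => //.
  by rewrite -[x]mul1r scalerAl; apply: PM.
by exists I => //; apply/left_idealP=> a x /IP Px; apply/IP; apply: PM.
Qed.

Lemma ideal_of_prop (P : A -> Prop) :
    P 0 -> (forall x y, P x -> P y -> P (x + y)) ->
    (forall a x, P x -> P (a * x)) -> (forall a x, P x -> P (x * a)) ->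
  exists2 I, ideal I & forall x, x \in I <-> P x.
Proof.
move=> P0 PD PMl PMr; have [I /left_idealP lI IP] := left_ideal_of_prop P0 PD PMl.
by exists I => //; apply/idealP; split=> // a x /IP Px; apply/IP/PMr.
Qed.

(** [e] is the component of 1 in [I] along a complementary left ideal [J]; for [x] in [I], [x e - x]
    lies in both. *)
Lemma left_ideal_idempotent I : semisimple_algebra A -> left_ideal I ->
  exists2 e, e \in I & forall x, x \in I -> x * e = x.
Proof.
move=> ssA lI; have [J [lJ sIJ dIJ]] := ssA I lI.
have /memv_addP[e eI [f fJ ef]] : 1 \in (I + J)%VS by rewrite sIJ memvf.
exists e => // x xI; apply/eqP; rewrite -subr_eq0 -memv0 -dIJ memv_cap.
have xeI : x * e \in I by apply: (left_idealP I).1.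
rewrite rpredB //=.
have -> : x * e - x = - (x * f).
  by rewrite -[X in _ - X]mulr1 ef mulrDr opprD addrA subrr add0r.
by rewrite rpredN; apply: (left_idealP J).1.
Qed.

Definition trace_form (t : 'Hom(A, K^o)) : Prop :=
  (forall x y, t (x * y) = t (y * x)) /\
  (forall x, (forall y, t (x * y) = 0) -> x = 0).

(** The radical of the form is a left ideal, hence generated by an idempotent, whose trace is 0. *)
Lemma semisimple_trace_form (t : 'Hom(A, K^o)) :
    semisimple_algebra A -> (forall x y, t (x * y) = t (y * x)) ->
    (forall e, e * e = e -> t e = 0 -> e = 0) ->
  trace_form t.
Proof.
move=> ssA tC t_idem; split=> // x tx0.
have [||| I lI IP] := @left_ideal_of_prop (fun x => forall y, t (x * y) = 0).
- by move=> y; rewrite mul0r linear0.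
- by move=> y z Hy Hz u; rewrite mulrDl linearD /= Hy Hz addr0.
- by move=> a y Hy z; rewrite -mulrA tC -mulrA Hy.
have [e eI idI] := left_ideal_idempotent ssA lI.
have e0 : e = 0.
  by apply: t_idem; [apply: idI | rewrite -[e]mulr1 (IP e).1].
by move/IP/idI: tx0; rewrite e0 mulr0.
Qed.

(* If I = A e, then for x in I the element y = x - e x of I satisfies
   t (y z) = 0 for all z, because t (e (x z)) = t ((x z) e) = t (x z). *)
Lemma ideal_central_idempotent (t : 'Hom(A, K^o)) I :
    semisimple_algebra A -> trace_form t -> ideal I ->
  exists c, [/\ c \in I, forall x, c * x = x * c
    & forall x, x \in I -> c * x = x].
Proof.
move=> ssA [tC t_nd] idI; have [Il Ir] := (idealP I).1 idI.
have [c cI cr] := left_ideal_idempotent ssA idI.1.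
have cl x : x \in I -> c * x = x.
  move=> xI; apply/esym/eqP; rewrite -subr_eq0; apply/eqP; apply: t_nd => z.
  by rewrite mulrBl linearB /= -mulrA (tC c) (cr (x * z)) ?Ir ?subrr.
exists c; split=> // x.
by rewrite -[c * x]cr ?Ir // -mulrA cl ?Il.
Qed.

End Ideals.

(** * Frobenius extensions obtained from trace forms *)

Section FrobeniusExtension.
Variables (K : fieldType) (S R : falgType K) (iota : 'Hom(S, R)).

Definition unital_morphism : Prop :=
  iota 1 = 1 /\ forall a b, iota (a * b) = iota a * iota b.

(* A bimodule map E from R to S and dual bases p.1, p.2 for p in xy. *)
Definition frobenius_system (E : 'Hom(R, S)) (xy : seq (R * R)) : Prop :=
  [/\ forall s a, E (iota s * a) = s * E a,
      forall a s, E (a * iota s) = E a * s,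
      forall a, \sum_(p <- xy) p.1 * iota (E (p.2 * a)) = a
    & forall a, \sum_(p <- xy) iota (E (a * p.1)) * p.2 = a].

Definition frobenius_extension : Prop :=
  exists E xy, frobenius_system E xy.

Variables (t : 'Hom(R, K^o)).
Hypotheses (iotaM : unital_morphism) (tR : trace_form t).

(** [E] is the adjoint of [iota] for the two forms: [h] identifies [S] with its dual, and [g a] is
    the functional [s |-> t (a * iota s)]. *)
Lemma conditional_expectation : trace_form (t \o iota) ->
  exists E : 'Hom(R, S), forall a s, t (iota (E a * s)) = t (a * iota s).
Proof.
case=> _ tS_nd; have [i1 iM] := iotaM.
have [g gE] : exists g : 'Hom(R, 'Hom(S, K^o)),
    g =1 (fun a => t \o (amull a \o iota))%VF.
  apply: lfun_of_linear => k x y; apply/lfunP=> s.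
  rewrite add_lfunE scale_lfunE !comp_lfunE !lfunE /=.
  by rewrite mulrDl -scalerAl linearP.
pose h := (g \o iota)%VF.
have hE s s' : h s s' = t (iota (s * s')).
  by rewrite comp_lfunE gE !comp_lfunE lfunE /= iM.
have h_onto : limg h = fullv.
  have ker0 : (fullv :&: lker h = 0)%VS.
    apply/eqP; rewrite capfv; apply/lker0P=> x y /lfunP hxy.
    apply/eqP; rewrite -subr_eq0; apply/eqP; apply: tS_nd => s.
    by rewrite comp_lfunE mulrBl !linearB /= -!hE hxy subrr.
  apply/eqP; rewrite eqEdim subvf (limg_dim_eq ker0) !dimvf /=.
  by change (dim S * 1 <= dim S)%N; rewrite muln1.
exists (h^-1 \o g)%VF => a s.
rewrite -hE [(_ \o g)%VF a]comp_lfunE limg_lfunVK ?h_onto ?memvf //.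
by rewrite gE !comp_lfunE lfunE.
Qed.

(** Adjointness makes [E] a bimodule map. Dual bases are built by induction on a spanning list; each
    step uses [regular], where the semisimplicity of [S] enters. *)
Lemma semisimple_frobenius_extension :
    semisimple_algebra S -> trace_form (t \o iota) -> frobenius_extension.
Proof.
move=> ssS tS; have [E EP] := conditional_expectation tS.
have [i1 iM] := iotaM; have [tC t_nd] := tR; have [_ tS_nd] := tS.
have t1 x y : (forall z, t (x * z) = t (y * z)) -> x = y.
  move=> xy; apply/eqP; rewrite -subr_eq0; apply/eqP; apply: t_nd => z.
  by rewrite mulrBl linearB /= xy subrr.
have t2 x y : (forall z, t (iota (x * z)) = t (iota (y * z))) -> x = y.
  move=> xy; apply/eqP; rewrite -subr_eq0; apply/eqP; apply: tS_nd => z.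
  by rewrite comp_lfunE mulrBl !linearB /= xy subrr.
have El s a : E (iota s * a) = s * E a.
  apply: t2 => z; rewrite EP -mulrA tC -mulrA -iM -EP.
  by rewrite !iM tC -mulrA.
have Er a s : E (a * iota s) = E a * s.
  by apply: t2 => z; rewrite EP -mulrA -iM -EP mulrA.
have regular a : exists y, a * iota (E (y * a)) = a.
  pose u := (E \o amulr a)%VF.
  have uE x : u x = E (x * a) by rewrite comp_lfunE lfunE.
  (* If the left ideal E(R a) of S is S E(y a) with E(y a) idempotent, then
     E(z (a E(y a) - a)) = 0 for all z, whence a E(y a) = a. *)
  have lu : left_ideal (limg u).
    apply/left_idealP=> s _ /memv_imgP[x _ ->].
    by rewrite uE -El mulrA -uE memv_img ?memvf.
  have [_ /memv_imgP[y _ ->] eP] := left_ideal_idempotent ssS lu.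
  exists y; rewrite -uE; apply: t1 => z; rewrite tC [RHS]tC.
  have := eP (u z); rewrite memv_img ?memvf // => /(_ isT) zP.
  by rewrite mulrA -EP -uE zP -[u z]mulr1 uE EP i1 mulr1.
have bases (zs : seq R) : exists xy : seq (R * R),
    forall z, z \in zs -> \sum_(p <- xy) p.1 * iota (E (p.2 * z)) = z.
  elim: zs => [|z zs [xy xyP]]; first by exists [::].
  pose P x := \sum_(p <- xy) p.1 * iota (E (p.2 * x)).
  have [y yP] := regular (z - P z).
  (* The new pair contributes [(z - P z) * iota (E (y * (x - P x)))]: zero on the earlier vectors,
     where [P x = x], and the missing [z - P z] at [x = z]. *)
  exists ((z - P z, y - \sum_(p <- xy) iota (E (y * p.1)) * p.2) :: xy) => x xzs.
  rewrite big_cons /= -/(P x).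
  have -> : E ((y - \sum_(p <- xy) iota (E (y * p.1)) * p.2) * x) = E (y * (x - P x)).
    rewrite mulrBl mulrBr !linearB /=; congr (_ - _).
    rewrite mulr_suml mulr_sumr !linear_sum /=; apply: eq_bigr => p _.
    by rewrite mulrA Er -mulrA El.
  move: xzs; rewrite inE => /orP[/eqP -> | /xyP xE].
    by rewrite yP subrK.
  by rewrite -/(P x) in xE; rewrite xE subrr mulr0 !linear0 mulr0 add0r.
have [xy xyP] := bases (vbasis {:R}).
have dual a : \sum_(p <- xy) p.1 * iota (E (p.2 * a)) = a.
  rewrite [a](coord_vbasis (memvf a)).
  under eq_bigr => p _ do rewrite mulr_sumr !linear_sum /= mulr_sumr.
  rewrite exchange_big /=; apply: eq_bigr => i _.
  rewrite -[in RHS](xyP _ (mem_nth 0 (_ : i < size (vbasis {:R}))%N)) ?size_tuple //.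
  rewrite scaler_sumr; apply: eq_bigr => p _.
  by rewrite -scalerAr !linearZ /= -scalerAr.
exists E, xy; split=> // a; apply: t1 => z; rewrite tC [RHS]tC.
rewrite -[in RHS](dual z) mulr_sumr mulr_suml !linear_sum /=.
apply: eq_bigr => p _.
by rewrite mulrA tC mulrA -EP -mulrA [RHS]tC -mulrA [RHS]tC -EP !iM tC.
Qed.
End FrobeniusExtension.

(** * Blocks and their links along a morphism *)

Section Blocks.
Variable K : fieldType.

(* The third clause says that e i generates a simple algebra. *)
Definition blocks (R : falgType K) (I : finType) (e : I -> R) : Prop :=
  [/\ forall i x, e i * x = x * e i,
      \sum_i e i = 1
    & forall i (J : {vspace R}), ideal J ->
        e i \in J \/ forall x, x \in J -> e i * x = 0].

Definition linked (S R : falgType K) (iota : 'Hom(S, R)) (I J : finType)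
    (e : I -> S) (f : J -> R) (i : I) (j : J) : bool :=
  iota (e i) * f j != 0.

Lemma preimage_annihilator (S R : falgType K) (iota : 'Hom(S, R)) (f : R) :
    unital_morphism iota -> (forall x, f * x = x * f) ->
  exists2 N : {vspace S}, ideal N & forall x, x \in N <-> iota x * f = 0.
Proof.
move=> [_ iM] fC; apply: ideal_of_prop => [|x y Hx Hy|a x Hx|a x Hx].
- by rewrite linear0 mul0r.
- by rewrite linearD mulrDl Hx Hy addr0.
- by rewrite iM -mulrA Hx mulr0.
- by rewrite iM -mulrA -fC mulrA Hx mul0r.
Qed.

(* Multiplication by g l is injective on f j R when f j and g l are linked,
   because f j R is simple; hence the converse direction. *)
Lemma linked_comp (S R T : falgType K) (iota : 'Hom(S, R)) (kappa : 'Hom(R, T))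
    (I J L : finType) (e : I -> S) (f : J -> R) (g : L -> T) i l :
    unital_morphism kappa -> blocks f -> blocks g ->
  linked (kappa \o iota) e g i l =
    [exists j, linked iota e f i j && linked kappa f g j l].
Proof.
move=> kM [fC f1 f_simple] [gC _ _]; have [k1 kmul] := kM.
rewrite /linked comp_lfunE; apply/idP/existsP => [nz | [j /andP[ef fg]]].
  apply/existsP; apply: contraNT nz; rewrite negb_exists => /forallP no_j.
  rewrite -[iota _]mulr1 -f1 mulr_sumr linear_sum mulr_suml big1 // => j _ /=.
  have := no_j j; rewrite negb_and !negbK => /orP[/eqP -> | /eqP fg].
    by rewrite linear0 mul0r.
  by rewrite kmul -mulrA fg mulr0.
apply: contraNN ef => /eqP eg0.
have [N idN NP] := preimage_annihilator kM (gC l).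
have [/NP fg0 | fN] := f_simple j N idN; first by rewrite fg0 eqxx in fg.
by rewrite -fC fN //; apply/NP.
Qed.

End Blocks.

(** * The endomorphism ring of a Frobenius extension *)

Section EndomorphismExtension.
Variables (K : fieldType) (S R : falgType K) (iota : 'Hom(S, R)).
Local Notation E1 := (right_endo iota).

Definition mk_right_endo (h : 'End(R)) : E1 := vsproj (right_endo_space iota) h.

Lemma mk_right_endoE (h : 'End(R)) :
  (forall x b, h (x * iota b) = h x * iota b) ->
  right_endo_fun (mk_right_endo h) =1 h.
Proof.
by move=> hP x; rewrite /right_endo_fun /mk_right_endo vsprojK //; apply/right_endoP.
Qed.

Lemma right_endo_inj (f g : E1) :
  right_endo_fun f =1 right_endo_fun g -> f = g.
Proof. by move=> fg; apply: (@subvs_inj _ _ (right_endo_space iota)); apply/lfunP. Qed.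

Lemma right_endo_linear x : linear (fun f : E1 => right_endo_fun f x).
Proof. by move=> a f g; rewrite /right_endo_fun linearP add_lfunE scale_lfunE. Qed.

Lemma right_endo_sum (I : Type) (r : seq I) (F : I -> E1) x :
  right_endo_fun (\sum_(i <- r) F i) x = \sum_(i <- r) right_endo_fun (F i) x.
Proof.
have [g gE] := lfun_of_linear (right_endo_linear x).
by rewrite -[LHS]gE linear_sum; apply: eq_bigr => i _; apply: gE.
Qed.

Lemma right_endo0 x : right_endo_fun (0 : E1) x = 0.
Proof.
by have [g gE] := lfun_of_linear (right_endo_linear x); rewrite -[LHS]gE linear0.
Qed.

Lemma right_endoD (f g : E1) x :
  right_endo_fun (f + g) x = right_endo_fun f x + right_endo_fun g x.
Proof.
by have [h hE] := lfun_of_linear (right_endo_linear x); rewrite -!hE linearD.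
Qed.

Lemma right_endo_right (f : E1) x b :
  right_endo_fun f (x * iota b) = right_endo_fun f x * iota b.
Proof. by move: x b; apply/right_endoP; apply: subvsP. Qed.

Lemma left_mult_unital : unital_morphism (left_mult iota).
Proof.
split=> [|a b]; apply: right_endo_inj => x.
  by rewrite left_multE right_endo1 mul1r.
by rewrite right_endoM !left_multE mulrA.
Qed.

Hypotheses (iotaM : unital_morphism iota).

(* With dual bases x_p, y_p, the expectation f |-> sum_p f(x_p) y_p has dual
   bases X_p : z |-> x_p E(z) and Y_p : z |-> E(y_p z). *)
Lemma right_endo_frobenius :
  frobenius_extension iota -> frobenius_extension (left_mult iota).
Proof.
case=> E [xy [El Er dl dr]]; have [i1 iM] := iotaM.
have [F FE] : exists F : 'Hom(E1, R),
    F =1 (fun f => \sum_(p <- xy) right_endo_fun f p.1 * p.2).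
  apply: lfun_of_linear => a f g; rewrite scaler_sumr -big_split /=.
  apply: eq_bigr => p _; rewrite right_endo_linear.
  by rewrite mulrDl scalerAl.
pose X x := mk_right_endo (amull x \o iota \o E)%VF.
pose Y y := mk_right_endo (iota \o E \o amull y)%VF.
have XE x z : right_endo_fun (X x) z = x * iota (E z).
  rewrite mk_right_endoE => [|u b]; rewrite !comp_lfunE !lfunE //=.
  by rewrite Er iM mulrA.
have YE y z : right_endo_fun (Y y) z = iota (E (y * z)).
  rewrite mk_right_endoE => [|u b]; rewrite !comp_lfunE !lfunE //=.
  by rewrite mulrA Er iM.
have expand (f : E1) x : right_endo_fun f x =
    \sum_(p <- xy) right_endo_fun f p.1 * iota (E (p.2 * x)).
  rewrite -[in LHS](dl x) linear_sum; apply: eq_bigr => p _.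
  by rewrite /= right_endo_right.
exists F, [seq (X p.1, Y p.2) | p <- xy]; split=> [a f | f a | f | f].
- rewrite !FE mulr_sumr; apply: eq_bigr => p _.
  by rewrite right_endoM left_multE mulrA.
- rewrite !FE mulr_suml.
  under eq_bigr => p _ do rewrite right_endoM left_multE expand mulr_suml.
  rewrite exchange_big; apply: eq_bigr => q _ /=.
  rewrite -[in RHS]mulrA -[in RHS](dr (q.2 * a)) mulr_sumr.
  by apply: eq_bigr => p _; rewrite !mulrA.
- apply: right_endo_inj => x; rewrite right_endo_sum big_map /= expand.
  under eq_bigr => p _.
    rewrite right_endoM XE left_multE FE mulr_suml !linear_sum /= mulr_sumr.
    over.
  rewrite exchange_big; apply: eq_bigr => q _ /=.
  rewrite -[in RHS](dl (right_endo_fun f q.1)) mulr_suml.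
  by apply: eq_bigr => p _; rewrite right_endoM YE -mulrA El iM mulrA.
- apply: right_endo_inj => x; rewrite right_endo_sum big_map /= expand.
  apply: eq_bigr => p _; rewrite right_endoM YE left_multE FE.
  congr (_ * _).
  under eq_bigr => q _ do rewrite right_endoM XE right_endo_right -mulrA.
  rewrite -mulr_sumr -[RHS]mulr1; congr (_ * _).
  by rewrite -[RHS]dr; apply: eq_bigr => q _; rewrite mul1r.
Qed.

(* If J is an ideal of End(R), the s such that z |-> x s E(y z) is always in J
   form an ideal of S, to which the simplicity of the blocks of S applies. *)
Lemma right_endo_blocks (I : finType) (e : I -> S) :
    frobenius_extension iota -> blocks e ->
  exists2 r : I -> E1, blocks r &
    forall i x, right_endo_fun (r i) x = x * iota (e i).
Proof.
case=> E [xy [El Er dl dr]] [eC e1 e_simple]; have [i1 iM] := iotaM.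
pose r i : E1 := mk_right_endo (amulr (iota (e i))).
have rE i x : right_endo_fun (r i) x = x * iota (e i).
  rewrite mk_right_endoE => [|u b]; rewrite !lfunE //=.
  by rewrite -!mulrA -!iM eC.
exists r => //; split=> [i f||i J].
- by apply: right_endo_inj => x; rewrite !right_endoM !rE right_endo_right.
- apply: right_endo_inj => x; rewrite right_endo_sum right_endo1.
  under eq_bigr => i _ do rewrite rE.
  by rewrite -mulr_sumr -linear_sum /= e1 i1 mulr1.
move=> idJ; have [Jl Jr] := (idealP J).1 idJ.
pose T x y s := mk_right_endo (amull x \o iota \o amull s \o E \o amull y)%VF.
have TE x y s z : right_endo_fun (T x y s) z = x * iota (s * E (y * z)).
  rewrite mk_right_endoE => [|u b]; rewrite !comp_lfunE !lfunE //=.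
  by rewrite mulrA Er !iM !mulrA.
have [|s s' Hs Hs' x y|a s Hs x y|a s Hs x y|N idN NP] :=
    @ideal_of_prop _ S (fun s => forall x y, T x y s \in J).
- move=> x y; rewrite (_ : T x y 0 = 0) ?rpred0 //; apply: right_endo_inj => z.
  by rewrite TE right_endo0 mul0r linear0 mulr0.
- have -> : T x y (s + s') = T x y s + T x y s'.
    apply: right_endo_inj => z.
    by rewrite right_endoD !TE mulrDl linearD mulrDr.
  by rewrite rpredD.
- have -> : T x y (a * s) = T (x * iota a) y s.
    by apply: right_endo_inj => z; rewrite !TE !iM !mulrA.
  by apply: Hs.
- have -> : T x y (s * a) = T x (iota a * y) s.
    by apply: right_endo_inj => z; rewrite !TE -[in RHS]mulrA El mulrA.
  by apply: Hs.
have [/NP eN | eN] := e_simple i N idN.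
  left; rewrite (_ : r i = \sum_(p <- xy) T p.1 p.2 (e i)).
    by rewrite rpred_sum // => p _; apply: eN.
  apply: right_endo_inj => z; rewrite right_endo_sum rE -{1}[z]dl mulr_suml.
  by apply: eq_bigr => p _; rewrite TE -mulrA -iM eC.
(* Placing [g] between two operators [T] with coefficient 1 gives one with coefficient
   [E (p.2 * g z)]; this coefficient is therefore in [N] and is killed by [e i]. *)
right=> g gJ; apply: right_endo_inj => z.
rewrite right_endoM right_endo0 rE -right_endo_right -[LHS]dl.
rewrite big1 // => p _; rewrite right_endo_right mulrA Er -eC eN ?linear0 ?mulr0 //.
apply/NP => x y.
have -> : T x y (E (p.2 * right_endo_fun g z)) = T x p.2 1 * g * T z y 1.
  apply: right_endo_inj => u; rewrite !right_endoM !TE !mul1r.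
  by rewrite right_endo_right mulrA Er.
by apply/Jr/Jl.
Qed.

End EndomorphismExtension.

(** * Isomorphisms of modules and the action of central elements *)

Lemma isomorphic_modules_sym (R : nzRingType) (V W : lmodType R) :
  isomorphic_modules V W -> isomorphic_modules W V.
Proof.
case=> f [g fK gK].
have g_lin : linear g.
  by move=> a x y; apply: (can_inj fK); rewrite linearP !gK.
pose m := GRing.isSemilinear.Build R W V _ g (GRing.semilinear_linear g_lin).
pose gl : {linear W -> V} := HB.pack g m.
by exists gl; exists f.
Qed.

Lemma isomorphic_modules_trans (R : nzRingType) (U V W : lmodType R) :
  isomorphic_modules U V -> isomorphic_modules V W -> isomorphic_modules U W.
Proof.
by case=> f bij_f [g bij_g]; exists (g \o f : {linear U -> W}); apply: bij_comp.
Qed.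

Lemma central_simple_module (R : nzRingType) (V : lmodType R) (c : R) :
    simple_module V -> (forall x, c * x = x * c) ->
  (forall v : V, c *: v = 0) \/ (forall v : V, c *: v = 0 -> v = 0).
Proof.
move=> [_ simV] cC.
have [|ker0|kerT] := simV [pred v : V | c *: v == 0]; last by left=> v; apply/eqP/kerT.
  split=> [|a u v]; rewrite !inE ?scaler0 // => /eqP cu /eqP cv.
  by rewrite scalerDr scalerA cC -scalerA cu cv scaler0 addr0.
by right=> v cv; apply: ker0; rewrite inE cv.
Qed.

(** * Minimal left ideals as simple modules *)

Section MinimalLeftIdeals.
Variables (K : fieldType) (S : falgType K).

Definition minimal_left_ideal (L : {vspace S}) : Prop :=
  [/\ left_ideal L, L <> 0%VS
    & forall I, left_ideal I -> (I <= L)%VS -> I = 0%VS \/ I = L].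

Lemma exists_minimal_left_ideal (I : {vspace S}) :
    left_ideal I -> I <> 0%VS ->
  exists2 L, minimal_left_ideal L & (L <= I)%VS.
Proof.
have [n] := ubnP (\dim I); elim: n I => // n IHn I ltIn lI I0.
have [[J [lJ J0 sJI neJI]] | minI] :=
    pselect (exists J, [/\ left_ideal J, J <> 0%VS, (J <= I)%VS & J <> I]).
  have [||//|L minL sLJ] := IHn J.
  - rewrite -ltnS; apply: leq_trans ltIn; rewrite ltnS ltn_neqAle dimvS // andbT.
    by apply/eqP => dJI; apply/neJI/eqP; rewrite eqEdim sJI dJI /=.
  - by [].
  by exists L => //; apply: subv_trans sJI.
exists I => //; split=> // J lJ sJI; apply: contrapT => /not_orP[J0 JI].
by apply: minI; exists J.
Qed.

Variable (L : {vspace S}).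

(** [subvs_of L] is already a space over [K], so a separate type carries the scaling by [S]; the
    proof argument is what justifies that scaling. *)
Definition ideal_module of left_ideal L : Type := subvs_of L.

Variable (lL : left_ideal L).
HB.instance Definition _ := GRing.Zmodule.copy (ideal_module lL) (subvs_of L).

Definition ideal_val (x : ideal_module lL) : S := vsval (x : subvs_of L).

Definition ideal_scale (a : S) (x : ideal_module lL) : ideal_module lL :=
  vsproj L (a * ideal_val x).

Lemma ideal_valP x : ideal_val x \in L. Proof. exact: subvsP. Qed.

Lemma ideal_val_inj : injective ideal_val. Proof. exact: subvs_inj. Qed.

Lemma ideal_valD x y : ideal_val (x + y) = ideal_val x + ideal_val y.
Proof. by []. Qed.

Lemma ideal_val_scale a x : ideal_val (ideal_scale a x) = a * ideal_val x.
Proof. by rewrite [LHS]vsprojK // (left_idealP L).1 // ideal_valP. Qed.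

Fact ideal_scaleA a b x : ideal_scale a (ideal_scale b x) = ideal_scale (a * b) x.
Proof. by apply: ideal_val_inj; rewrite !ideal_val_scale mulrA. Qed.

Fact ideal_scale1 : left_id 1 ideal_scale.
Proof. by move=> x; apply: ideal_val_inj; rewrite ideal_val_scale mul1r. Qed.

Fact ideal_scaleDr : right_distributive ideal_scale +%R.
Proof.
by move=> a x y; apply: ideal_val_inj; rewrite ideal_valD !ideal_val_scale mulrDr.
Qed.

Fact ideal_scaleDl x : {morph ideal_scale^~ x : a b / a + b}.
Proof.
by move=> a b; apply: ideal_val_inj; rewrite ideal_valD !ideal_val_scale mulrDl.
Qed.

HB.instance Definition _ := GRing.Zmodule_isLmodule.Build S (ideal_module lL)
  ideal_scaleA ideal_scale1 ideal_scaleDr ideal_scaleDl.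

Lemma ideal_valZ a (x : ideal_module lL) : ideal_val (a *: x) = a * ideal_val x.
Proof. exact: ideal_val_scale. Qed.

Lemma ideal_val_onto x : x \in L -> exists u : ideal_module lL, ideal_val u = x.
Proof. by move=> xL; exists (vsproj L x); apply: vsprojK. Qed.

Hypothesis minL : minimal_left_ideal L.

Lemma minimal_left_ideal_simple : simple_module (ideal_module lL).
Proof.
have [_ L0 L_min] := minL; split.
  have [u uv] := ideal_val_onto (memv_pick L).
  exists u; apply/eqP => u0; move: uv; rewrite u0 => /esym/eqP.
  by rewrite vpick0 => /eqP.
move=> U [U0 UP].
have [|x y [u uU <-] [v vU <-]|a x [u uU <-]|I lI IP] :=
    @left_ideal_of_prop _ S
      (fun x => exists2 u : ideal_module lL, u \in U & ideal_val u = x).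
- by exists 0.
- by exists (u + v) => //; rewrite -[u]scale1r; apply: UP.
- by exists (a *: u); rewrite ?ideal_valZ // -[a *: u]addr0; apply: UP.
have sIL : (I <= L)%VS by apply/subvP => x /IP[u _ <-]; apply: ideal_valP.
case: (L_min I lI sIL) => defI; [left=> u uU | right=> u].
  apply: ideal_val_inj; apply/eqP; rewrite -memv0 -defI; apply/IP.
  by exists u.
have /IP[v vU /ideal_val_inj <-//] : ideal_val u \in I by rewrite defI ideal_valP.
Qed.

(** Schur's lemma for [u |-> u v]: the kernel is a left ideal properly inside [L], the image a
    nonzero submodule of [V]. *)
Lemma minimal_left_ideal_iso (V : lmodType S) (x : S) (v : V) :
    simple_module V -> x \in L -> x *: v != 0 ->
  isomorphic_modules (ideal_module lL) V.
Proof.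
move=> [_ simV] xL xv; have [_ L0 L_min] := minL.
pose f (u : ideal_module lL) := ideal_val u *: v.
have f_lin : linear f.
  by move=> a y z; rewrite /f ideal_valD ideal_valZ scalerDl scalerA.
pose m := GRing.isSemilinear.Build S (ideal_module lL) V _ f
  (GRing.semilinear_linear f_lin).
pose fl : {linear ideal_module lL -> V} := HB.pack f m.
have f_inj : injective f.
  have [|y z [yL yv] [zL zv]|a y [yL yv]|I lI IP] :=
      @left_ideal_of_prop _ S (fun y => y \in L /\ y *: v = 0).
  - by rewrite mem0v scale0r.
  - by rewrite rpredD // scalerDl yv zv addr0.
  - by rewrite (left_idealP L).1 // -scalerA yv scaler0.
  have sIL : (I <= L)%VS by apply/subvP => y /IP[].
  have I0 : I = 0%VS.
    case: (L_min I lI sIL) => // IL.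
    by move: xL xv; rewrite -IL => /IP[_ ->]; rewrite eqxx.
  move=> y z /eqP; rewrite -subr_eq0 -scalerBl => /eqP yz.
  apply: ideal_val_inj; apply/eqP; rewrite -subr_eq0 -memv0 -I0; apply/IP.
  by rewrite rpredB ?ideal_valP.
have [|im0|imT] := simV [pred w | `[< exists u, f u = w >]].
- split=> [|a y z]; rewrite !inE.
    by apply/asboolP; exists 0; apply: scale0r.
  move=> /asboolP[u <-] /asboolP[w <-]; apply/asboolP; exists (a *: u + w).
  exact: f_lin.
- case/eqP: xv; apply: im0; rewrite inE; apply/asboolP.
  by have [u <-] := ideal_val_onto xL; exists u.
have /choice[g gK] w : exists u, f u = w by apply/asboolP/imT.
by exists fl; exists g => // u; apply: f_inj; rewrite gK.
Qed.

End MinimalLeftIdeals.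

(** * Blocks attached to the simple modules *)

Section SimpleModuleBlocks.
Variables (K : fieldType) (S : falgType K).

(* The second clause says that W i is faithful over the block of e i. *)
Definition module_blocks n (W : 'I_n -> lmodType S) (e : 'I_n -> S) : Prop :=
  (forall i k (w : W k), e i *: w = w *+ (i == k)) /\
  (forall i x, (forall w : W i, x *: w = 0) -> e i * x = 0).

(** [e i] is [1 - c], where the central idempotent [c] generates the annihilator of [W i]. *)
Lemma semisimple_blocks (t : 'Hom(S, K^o)) n (W : 'I_n -> lmodType S) :
    semisimple_algebra S -> trace_form t -> simple_modules W ->
  exists2 e, blocks e & module_blocks W e.
Proof.
move=> ssS tS [W_simple W_inj W_all].
have /choice[e eP] i : exists e, [/\ forall x, e * x = x * e,
    forall w : W i, e *: w = w
    & forall x, (forall w : W i, x *: w = 0) -> e * x = 0].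
  have [|x y Hx Hy w|a x Hx w|a x Hx w|N idN NP] :=
      @ideal_of_prop _ S (fun x => forall w : W i, x *: w = 0).
  - by move=> w; rewrite scale0r.
  - by rewrite scalerDl Hx Hy addr0.
  - by rewrite -scalerA Hx scaler0.
  - by rewrite -scalerA Hx.
  have [c [cN cC c1]] := ideal_central_idempotent ssS tS idN.
  exists (1 - c); split=> [x|w|x /NP/c1 cx].
  - by rewrite mulrBl mulrBr mul1r mulr1 cC.
  - by rewrite scalerBl scale1r (NP c).1 // subr0.
  - by rewrite mulrBl mul1r cx subrr.
have eC i x : e i * x = x * e i by have [/(_ x)] := eP i.
have e1 i (w : W i) : e i *: w = w by have [_ /(_ w)] := eP i.
have e0 i x : (forall w : W i, x *: w = 0) -> e i * x = 0.
  by have [_ _ /(_ x)] := eP i.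
have ee i : e i * e i = e i.
  apply/eqP; rewrite -subr_eq0 -[X in _ - X]mulr1 -mulrBr; apply/eqP/e0 => w.
  by rewrite scalerBl e1 scale1r subrr.
have e_simple i (J : {vspace S}) : ideal J ->
    e i \in J \/ forall x, x \in J -> e i * x = 0.
  move=> idJ; have [c [cJ cC c1]] := ideal_central_idempotent ssS tS idJ.
  have [c0|ker0] := central_simple_module (W_simple i) cC.
    by right=> x xJ; apply: e0 => w; rewrite -(c1 x xJ) -scalerA c0.
  left; suff -> : e i = e i * c by apply: ((idealP J).1 idJ).1.
  apply/eqP; rewrite -subr_eq0 -[X in X - _]mulr1 -mulrBr; apply/eqP/e0 => w.
  apply: ker0; rewrite scalerA mulrBr mulr1 (c1 c cJ) subrr scale0r //.
have left_mulP (c : S) : left_ideal (limg (amulr c)).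
  apply/left_idealP => a _ /memv_imgP[x _ ->].
  by apply/memv_imgP; exists (a * x); rewrite ?memvf // !lfunE /= mulrA.
have mulr_neq0 (c : S) : c != 0 -> limg (amulr c) <> 0%VS.
  move=> /eqP c0 img0; apply/c0/eqP; rewrite -memv0 -img0.
  by apply/memv_imgP; exists 1; rewrite ?memvf // lfunE /= mul1r.
(* As [e i] is not in the annihilator of [W k], it kills that annihilator; so a nonzero element of
   [L], being fixed by [e i], acts nontrivially on [W k]. *)
have W_iso (L : {vspace S}) (lL : left_ideal L) i k : minimal_left_ideal L ->
    (forall x, x \in L -> e i * x = x) -> (forall w : W k, e i *: w = 0 -> w = 0) ->
    isomorphic_modules (ideal_module lL) (W k).
  move=> minL eL ker0; have [[w0 /eqP w0_neq0] _] := W_simple k.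
  have [|x y Hx Hy w|a x Hx w|a x Hx w|N idN NP] :=
      @ideal_of_prop _ S (fun x => forall w : W k, x *: w = 0).
  - by move=> w; rewrite scale0r.
  - by rewrite scalerDl Hx Hy addr0.
  - by rewrite -scalerA Hx scaler0.
  - by rewrite -scalerA Hx.
  have [/NP eN | eN] := e_simple i N idN; first by case: w0_neq0; apply: ker0.
  have xL := memv_pick L; have [_ L0 _] := minL.
  have [[w xw]|noW] := pselect (exists w : W k, vpick L *: w != 0).
    exact: (minimal_left_ideal_iso lL minL (W_simple k) xL xw).
  case: L0; apply/eqP; rewrite -vpick0 -(eL _ xL); apply/eqP/eN/NP => w.
  by apply/eqP; apply: contrapT => /negP xw; apply: noW; exists w.
(* If [e i] acted injectively on [W k], a minimal left ideal inside [S e_i] would be isomorphic to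
   both [W i] and [W k]. *)
have e_ortho i k (w : W k) : e i *: w = w *+ (i == k).
  case: eqP => [ik|neq_ik]; first by case: k / ik w => w; rewrite e1.
  have [->//|ker0] := central_simple_module (W_simple k) (eC i).
  have ei0 : e i != 0.
    apply/eqP => ei0; have [[w0 /eqP]] := W_simple i.
    by rewrite -(e1 i w0) ei0 scale0r.
  have [L minL sL] := exists_minimal_left_ideal (left_mulP _) (mulr_neq0 _ ei0).
  have [lL _ _] := minL.
  have eL x : x \in L -> e i * x = x.
    by move=> /(subvP sL)/memv_imgP[y _ ->]; rewrite lfunE /= eC -mulrA ee.
  case: neq_ik; apply: W_inj.
  apply: isomorphic_modules_trans (W_iso L lL i k minL eL ker0).
  by apply/isomorphic_modules_sym/(W_iso L lL i i) => // v; rewrite e1.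
have e_mul i k : i != k -> e i * e k = 0.
  by move=> /negPf neq; apply: e0 => w; rewrite e_ortho eq_sym neq.
exists e => //; split=> //.
(* If the sum fell short of 1 by [f], a minimal left ideal inside [S f] would be a simple module
   killed by every [e i], hence isomorphic to no [W i]. *)
apply/esym/eqP; rewrite -subr_eq0; apply: contrapT => /negP f_neq0.
set f := 1 - _ in f_neq0.
have ef i : e i * f = 0.
  rewrite mulrBr mulr1 mulr_sumr (bigD1 i) //= ee big1 ?addr0 ?subrr // => k ki.
  by rewrite e_mul // eq_sym.
have [L minL sL] := exists_minimal_left_ideal (left_mulP _) (mulr_neq0 _ f_neq0).
have [lL _ _] := minL.
have L_simple := minimal_left_ideal_simple lL minL.
have [i [h [h' hK _]]] := W_all _ L_simple; have [[u /eqP u0] _] := L_simple.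
case: u0; apply: (can_inj hK); rewrite linear0 -[LHS]e1 -linearZ /=.
rewrite (_ : e i *: u = 0) ?linear0 //; apply: ideal_val_inj; rewrite ideal_valZ.
have /(subvP sL)/memv_imgP[y _ ->] := ideal_valP u.
by rewrite lfunE /= mulrA eC -mulrA ef mulr0.
Qed.

End SimpleModuleBlocks.

(** [f j] is the identity on [V j], which is faithful over its block, so the link vanishes exactly
    when [e i] kills [V j]. On [V j], [e i] projects onto the copies of [W i]. *)
Lemma inclusion_matrix_linked (K : fieldType) (S R : falgType K)
    (iota : 'Hom(S, R)) r s (W : 'I_r -> lmodType S) (V : 'I_s -> lmodType R)
    (M : 'M[nat]_(r, s)) (e : 'I_r -> S) (f : 'I_s -> R) i j :
    (forall k, simple_module (W k)) -> module_blocks W e -> module_blocks V f ->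
    (forall x, f j * x = x * f j) ->
    inclusion_matrix iota W V M ->
  linked iota e f i j = (0 < M i j)%N.
Proof.
move=> W_simple [eW _] [fV f0] fC /(_ j)[g [g' gK g'K]].
pose copies : finType := {i : 'I_r & 'I_(M i j)}.
pose G (w : {ffun forall p : copies, W (tag p)}) := \sum_p g p (w p).
have GE w : iota (e i) *: G w = G [ffun p : copies => e i *: w p : W (tag p)].
  rewrite /G scaler_sumr; apply: eq_bigr => p _.
  by rewrite ffunE linearZ_LR.
have G0 : G [ffun p : copies => 0 : W (tag p)] = 0.
  by rewrite /G big1 // => p _; rewrite ffunE linear0.
rewrite /linked; apply/idP/idP => [|Mij].
  apply: contraTT; rewrite -leqNgt leqn0 negbK => /eqP M0.
  rewrite -fC; apply/eqP/f0 => v.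
  rewrite -[v]g'K -/(G _) GE -[RHS]G0; congr G; apply/ffunP => -[k m].
  rewrite !ffunE eW /=; case: eqP => // ik.
  by exfalso; case: m => m /=; rewrite -ik M0.
apply/negP => /eqP ef0.
pose u : {ffun forall p : copies, W (tag p)} :=
  [ffun p => sval (cid (W_simple (tag p)).1)].
have eu0 : iota (e i) *: G u = 0.
  by have := fV j j (G u); rewrite eqxx mulr1n => <-; rewrite scalerA ef0 scale0r.
move: eu0; rewrite GE -G0 => /(can_inj gK)/ffunP/(_ (Tagged _ (Ordinal Mij))).
rewrite !ffunE eW eqxx mulr1n; case: cid => w /= w0 uw; case/eqP: w0.
exact: uw.
Qed.

(** * A criterion for normality in terms of links *)

Lemma unital_morphism_comp (K : fieldType) (S R T : falgType K)
    (iota : 'Hom(S, R)) (kappa : 'Hom(R, T)) :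
  unital_morphism iota -> unital_morphism kappa -> unital_morphism (kappa \o iota)%VF.
Proof.
by move=> [i1 iM] [k1 kM]; split=> [|a b]; rewrite !comp_lfunE ?i1 ?iM.
Qed.

(** By the last hypothesis, used in both directions, columns of links that share a row are equal;
    this makes [iota c] below central in [R]. *)
Lemma blocks_normal (K : fieldType) (S R : falgType K) (iota : 'Hom(S, R))
    (I J : finType) (e : I -> S) (f : J -> R) :
    unital_morphism iota -> blocks e -> blocks f ->
    (forall i l j k, linked iota e f i j -> linked iota e f i k ->
       linked iota e f l k -> linked iota e f l j) ->
  normal_subalgebra (limg iota).
Proof.
move=> iotaM [eC e1 e_simple] [fC f1 f_simple] supp N [idN N_proper N_max].
have [i1 iM] := iotaM.
have [j fjN] : exists j, f j \notin N.
  apply/existsP; apply: contra_notT N_proper.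
  rewrite negb_exists => /forallP fN.
  apply/eqP; rewrite eqEsubv subvf; apply/subvP => x _.
  rewrite -[x]mulr1; apply: ((idealP N).1 idN).1.
  by rewrite -f1 rpred_sum // => j _; have /negPn := fN j.
have fN0 x : x \in N -> f j * x = 0.
  by have [fN|] := f_simple j N idN; [rewrite fN in fjN | apply].
have [|x y Hx Hy|a x Hx|a x Hx|Z idZ ZP] := @ideal_of_prop _ R (fun x => f j * x = 0).
- by rewrite mulr0.
- by rewrite mulrDr Hx Hy addr0.
- by rewrite mulrA fC -mulrA Hx mulr0.
- by rewrite mulrA Hx mul0r.
have NZ x : x \in N <-> f j * x = 0.
  have sNZ : (N <= Z)%VS by apply/subvP => y yN; apply/ZP/fN0.
  rewrite -ZP; case: (N_max Z idZ sNZ) => [-> //|ZT].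
  have /ZP : (1 : R) \in Z by rewrite ZT memvf.
  by rewrite mulr1 => fj0; rewrite fj0 mem0v in fjN.
pose c := \sum_(i | ~~ linked iota e f i j) e i.
have cN : iota c \in (N :&: limg iota)%VS.
  rewrite memv_cap memv_img ?memvf // andbT linear_sum; apply/NZ.
  by rewrite mulr_sumr big1 // => i /negPn/eqP; rewrite /= fC.
have [Y idY YP] := preimage_annihilator iotaM (fC j).
(* A block linked to [f j] is outside the annihilator [Y], hence kills [Y] and in particular [b];
   only the blocks summed in [c] act on [b]. *)
have cE b : f j * iota b = 0 -> c * b = b.
  move=> fb; rewrite -[RHS]mul1r -e1 (bigID (linked iota e f ^~ j)) /= mulrDl.
  rewrite [X in _ = X + _]mulr_suml [X in _ = X + _]big1 ?add0r // => i ij.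
  have [/YP eY|eY] := e_simple i Y idY; first by rewrite /linked eY eqxx in ij.
  by rewrite eY //; apply/YP; rewrite -fC.
(* If a block in [c] is linked to [f k], then columns [j] and [k] are disjoint and [c] contains
   every block linked to [f k]. *)
have cf k : iota c * f k = 0 \/ iota c * f k = f k.
  rewrite linear_sum mulr_suml /=.
  have [[l /andP[lk lj]]|no_l] :=
      pselect (exists l, linked iota e f l k && ~~ linked iota e f l j).
    right; rewrite -[RHS]mul1r -i1 -e1 linear_sum /= mulr_suml.
    rewrite [RHS](bigID (linked iota e f ^~ j)) /= [X in _ = X + _]big1 ?add0r //.
    move=> i ij; apply/eqP; rewrite -[_ == 0]negbK; apply/negP => ik.
    by case/negP: lj; apply: supp ij ik lk.
  left; rewrite big1 // => i ij; apply/eqP; rewrite -[_ == 0]negbK.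
  by apply/negP => ik; apply: no_l; exists i; rewrite ij andbT.
have cC x : iota c * x = x * iota c.
  rewrite -[LHS]mulr1 -[RHS]mulr1 -f1 !mulr_sumr; apply: eq_bigr => k _.
  rewrite -[_ * f k]mulrA -fC mulrA -[in RHS]mulrA.
  by case: (cf k) => ->; rewrite ?mul0r ?mulr0 // fC.
have NE x : x \in (N :&: limg iota)%VS -> iota c * x = x.
  rewrite memv_cap => /andP[/NZ fx /memv_imgP[b _ xE]].
  by rewrite xE -iM cE // -xE.
apply/eqP; rewrite eqEsubv; apply/andP; split; apply/prodvP => x y.
  move=> xN _; rewrite -(NE x xN) -mulrA cC.
  by apply: memv_mul; rewrite ?memvf.
move=> _ yN; rewrite -(NE y yN) mulrA -cC -mulrA.
by apply: memv_mul; rewrite ?memvf.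
Qed.

(** * Supports of the alternating powers *)

Lemma mulmx_nat_gt0 m n p (A : 'M[nat]_(m, n)) (B : 'M[nat]_(n, p)) i k :
  (0 < (A *m B)%R i k)%N = [exists j, (0 < A i j)%N && (0 < B j k)%N].
Proof.
have -> : (A *m B) i k = (\sum_j A i j * B j k)%N by rewrite mxE.
rewrite lt0n sum_nat_eq0 negb_forall; apply: eq_existsb => j /=.
by rewrite -lt0n muln_gt0.
Qed.

Section Supports.
Variables (r s : nat) (M : 'M[nat]_(r, s)).

Lemma altfactorS n (i : 'I_(altdim r s n)) (j : 'I_(altdim r s n.+1)) :
  altfactor M n.+1 j i = altfactor M n i j.
Proof.
(* [altfactor] recurses by two, so two consecutive cases are proved together. *)
move: i j; suff [] : (forall (i : 'I_(altdim r s n)) (j : 'I_(altdim r s n.+1)),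
    altfactor M n.+1 j i = altfactor M n i j) /\
  (forall (i : 'I_(altdim r s n.+1)) (j : 'I_(altdim r s n.+2)),
    altfactor M n.+2 j i = altfactor M n.+1 i j) by [].
elim: n => [|n [IH0 IH1]]; last by split=> // i j; apply: IH0.
by split=> i j /=; rewrite mxE.
Qed.

(** With [M] seen as a bipartite graph, [C] is one side of a union of connected components. *)
Definition two_step_closed n (C : 'I_(altdim r s n) -> Prop) : Prop :=
  forall k l h, (0 < altfactor M n k h)%N -> (0 < altfactor M n l h)%N ->
    C k -> C l.

(** Walks of length [n] from [i] all end in the same component. Removing the last step replaces [C]
    by the set [C'] of its neighbours. *)
Lemma two_step_closed_support n C i k j :
    two_step_closed C -> (0 < altpow M n i k)%N -> (0 < altpow M n i j)%N ->
  C k -> C j.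
Proof.
elim: n C k j => [|n IHn] C k j Cclosed.
  by rewrite !mxE; do 2!case: eqP => // <-.
rewrite /= !mulmx_nat_gt0 => /existsP[k' /andP[ik' k'k]] /existsP[j' /andP[ij' j'j]] Ck.
pose C' (l : 'I_(altdim r s n)) := exists2 h, (0 < altfactor M n l h)%N & C h.
have [|h j'h Ch] := IHn C' _ _ _ ik' ij' (ex_intro2 _ _ k k'k Ck).
  move=> l l' h lh l'h [h' lh' Ch']; exists h => //.
  by apply: (Cclosed _ _ l _ _ Ch'); rewrite altfactorS.
by apply: (Cclosed _ _ j' _ _ Ch); rewrite altfactorS.
Qed.

(* Columns of M^(n+1) that share a row are joined by two-step moves, and by the
   depth bound such moves do not leave the support of a row. *)
Lemma depth_bound_support n i l j k : depth_bound M n.+2 ->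
    (0 < altpow M n.+1 i j)%N -> (0 < altpow M n.+1 i k)%N ->
  (0 < altpow M n.+1 l k)%N -> (0 < altpow M n.+1 l j)%N.
Proof.
case=> q q_gt0 q_bound ij ik.
apply: (two_step_closed_support (C := fun h => (0 < altpow M n.+1 l h)%N) _ ik ij).
move=> h h' x hx h'x lh.
(* The walk from [l] to [h], [x] and [h'] counts in [M^(n+3)], which the bound for [n+2] compares
   with [M^(n+1)]. *)
have : (0 < altpow M n.+3 l h')%N.
  rewrite [altpow M n.+3]/(altpow M n.+1 *m altfactor M n.+1 *m altfactor M n.+2).
  rewrite !mulmx_nat_gt0; apply/existsP; exists x; rewrite altfactorS h'x andbT.
  by rewrite mulmx_nat_gt0; apply/existsP; exists h; rewrite lh.
by move/leq_trans/(_ (q_bound l h')); rewrite muln_gt0 q_gt0.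
Qed.

End Supports.

(** * Blocks along the Jones tower *)

Section Tower.
Variables (K : fieldType) (A : falgType K) (B : {aspace A}).
Variables (r s : nat) (M : 'M[nat]_(r, s)).
Variables (e : 'I_r -> subvs_of B) (f : 'I_s -> A).
Hypotheses (unitalB : unital_morphism (embedding (jones B 0)))
  (frobB : frobenius_extension (embedding (jones B 0)))
  (e_blocks : blocks e) (f_blocks : blocks f)
  (efM : forall i j, linked (embedding (jones B 0)) e f i j = (0 < M i j)%N).

Lemma jones_embedding_unital k : unital_morphism (jones_embedding B k).
Proof.
elim: k => [|k kM]; first exact: unitalB.
exact: unital_morphism_comp kM (left_mult_unital _).
Qed.

(** The induction carries the blocks of both ends of the extension: those of the lower end give the
    blocks of the next algebra, and links from [B] compose through the upper end. *)
Lemma jones_blocks k :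
  [/\ unital_morphism (embedding (jones B k)),
      frobenius_extension (embedding (jones B k))
    & exists (g : 'I_(altdim r s k) -> lower (jones B k))
             (h : 'I_(altdim r s k.+1) -> upper (jones B k)),
      [/\ blocks g, blocks h,
          forall i j, linked (embedding (jones B k)) g h i j
                      = (0 < altfactor M k i j)%N
        & forall i j, linked (jones_embedding B k) e h i j
                      = (0 < altpow M k.+1 i j)%N]].
Proof.
elim: k => [|k [kM k_frob [g [h [g_blocks h_blocks gh eh]]]]].
  split=> //; exists e, f; split=> // i j.
  by rewrite efM /= mul1mx.
have [g' g'_blocks g'E] := right_endo_blocks kM k_frob g_blocks.
split; [exact: left_mult_unital | exact: right_endo_frobenius |].
have hg' i j : linked (left_mult (embedding (jones B k))) h g' i j
               = (0 < altfactor M k.+1 i j)%N.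
  (* The product in question is the map [x |-> h_i x g_j]; as [h i] is central, it vanishes as soon
     as its value at 1 does. *)
  rewrite altfactorS -gh /linked; congr (~~ _).
  have [hC _ _] := h_blocks; apply/eqP/eqP => [hg0|gh0].
    have := right_endoM (left_mult (embedding (jones B k)) (h i)) (g' j) 1.
    by rewrite hg0 right_endo0 left_multE g'E mul1r hC => <-.
  apply: right_endo_inj => x.
  by rewrite right_endoM right_endo0 left_multE g'E hC -mulrA gh0 mulr0.
(* [g'] is indexed by [altdim r s k], to which [altdim r s k.+2] is convertible. *)
exists h, g'; split=> // i j.
rewrite (linked_comp (jones_embedding B k) e i j
  (left_mult_unital (embedding (jones B k))) h_blocks g'_blocks).
rewrite [altpow M k.+2]/(altpow M k.+1 *m altfactor M k.+1) mulmx_nat_gt0.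
by apply: eq_existsb => l; rewrite eh hg'.
Qed.

End Tower.

Theorem corollary4p8 (R : realType) (A : falgType R[i]) (B : {aspace A})
    (n : nat) (unitB : 1 \in B)
    (ssA : semisimple_algebra A) (ssB : semisimple_algebra (subvs_of B))
    (hn : (2 <= n)%N) (depthB : has_depth B n) :
  normal_subalgebra (jones_base B (n - 2)).
Proof.
case: depthB => r [s [W [V [M [simW simV incM [_ M_depth _]]]]]].
(* With [n = k+2] the target is [E_k], where the links of [B] are the support of [M^(k+1)], the
   power on the right of the depth bound. *)
have [k nk] : exists k, n = k.+2 by case: n hn {M_depth} => [|[|k]] // _; exists k.
move: M_depth; rewrite {n hn}nk subn2 /= => M_depth.
pose iota : 'Hom(subvs_of B, A) := embedding (jones B 0).
have iotaE : iota =1 vsval by move=> b; rewrite lfunE.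
have iotaM : unital_morphism iota.
  split=> [|a b]; rewrite !iotaE //=.
  by apply/eqP; rewrite algid_eq1.
have [t [tC t_idem]] := algebra_trace A (Num.Theory.pchar_num _).
have tA : trace_form t by apply: semisimple_trace_form.
(* Idempotents of [B] are idempotents of [A], so [t] is nonzero on the nonzero ones. *)
have tB : trace_form (t \o iota)%VF.
  apply: semisimple_trace_form => // [x y | c cc].
    by rewrite !comp_lfunE !iotaM.2 tC.
  rewrite comp_lfunE => /t_idem c0; apply: val_inj.
  by rewrite /= -iotaE c0 // -iotaM.2 cc.
have [e e_blocks We] := semisimple_blocks ssB tB simW.
have [f f_blocks Vf] := semisimple_blocks ssA tA simV.
have frob := semisimple_frobenius_extension iotaM tA ssB tB.
have efM i j : linked iota e f i j = (0 < M i j)%N.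
  apply: (inclusion_matrix_linked i _ We Vf).
  - by move=> l; have [/(_ l)] := simW.
  - by move=> x; have [/(_ j)] := f_blocks.
  - by have <- : (fun b : subvs_of B => vsval b) = iota by apply/funext.
have [_ _ [g [h [_ h_blocks _ eh]]]] := jones_blocks iotaM frob e_blocks f_blocks efM k.
apply: (blocks_normal (jones_embedding_unital iotaM k) e_blocks h_blocks).
move=> i l j m; rewrite !eh; exact: depth_bound_support.
Qed.
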